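(* Let a biobjective robust problem $\mathrm{BRO}(\mathcal{U})$ be given such that (BRO-1) and (BRO-3) hold, and assume that $\mathcal{U}\subseteq\mathbb{R}^m$ is a polytope. Then the dichotomic search algorithm applied to $\mathrm{BRO}(\mathcal{U})$ (i.e. with $g=f^{\mathcal{U}}$) returns a set $Y^\ast$ containing all extreme supported nondominated points and a set $X^\ast$ containing a representative set of extreme supported efficient solutions of $\mathrm{BRO}(\mathcal{U})$, after $2|Y^\ast|-3$ iterations of its while-loop if $|Y^\ast|>2$ and after zero iterations if $|Y^\ast|=1$.
   Context: Orders: for $y,\bar y\in\mathbb{R}^p$, $\le$ and $<$ are componentwise; $y\preceq\bar y$ ($y$ dominates $\bar y$) means $y\le\bar y$ and $y\ne\bar y$. Problem: $\mathrm{BRO}(\mathcal{U})$ is the problem $\min_{x\in\mathcal{X}} f^{\mathcal{U}}(x)$ with $f^{\mathcal{U}}(x)=(f_1^{\mathcal{U}}(x),f_2^{\mathcal{U}}(x))^t$, $f_i^{\mathcal{U}}(x)=\sup_{\xi\in\mathcal{U}}f_i(x,\xi)$, where $f_1,f_2:\mathcal{X}\times\mathcal{U}\to\mathbb{R}$. (BRO-1): $\mathcal{X}=P\cap(\mathbb{Z}^k\times\mathbb{R}^{n-k})$ with $P\subseteq\mathbb{R}^n$ a polytope and $0\le k\le n$. (BRO-3): $f_1,f_2$ are linear in $x$ for every fixed $\xi\in\mathcal{U}$, and quasi-convex and continuous in $\xi$ for every fixed $x\in\mathcal{X}$. The sets $\mathcal{X}$ and $\mathcal{U}$ are nonempty.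 Solutions: for $\min_{x\in\mathcal{X}}g(x)$ with $\mathcal{Y}=g(\mathcal{X})$, $x\in\mathcal{X}$ is efficient and $g(x)$ nondominated if no $x'\in\mathcal{X}\setminus\{x\}$ has $g(x')\preceq g(x)$. A point $y\in\mathcal{Y}$ is extreme supported nondominated if there is no convex combination of nondominated points $y^{(1)},\dots,y^{(N)}\in\mathcal{Y}\setminus\{y\}$ with $\sum_i\lambda_iy^{(i)}\le y$; $x$ is extreme supported efficient if $g(x)$ is extreme supported nondominated. A representative set of extreme supported efficient solutions is a subset of $\mathcal{X}$ whose image under $g$ is exactly the set of extreme supported nondominated points. Dichotomic search for $\min_{x\in\mathcal{X}}(g_1(x),g_2(x))^t$: Compute $\epsilon_1=\min_{\mathcal{X}}g_1$, $x^L\in\arg\min_{x\in\mathcal{X}}\{g_2(x):g_1(x)\le\epsilon_1\}$, $y^L=g(x^L)$; $\epsilon_2=\min_{\mathcal{X}}g_2$, $x^R\in\arg\min_{x\in\mathcal{X}}\{g_1(x):g_2(x)\le\epsilon_2\}$, $y^R=g(x^R)$. If $y^L=y^R$, stop and return $Y^\ast=\{y^L\}$, $X^\ast=\{x^L\}$. Otherwise set $Y^\ast=\{y^L,y^R\}$, $X^\ast=\{x^L,x^R\}$, $\mathcal{L}=\{(y^L,y^R)\}$. While $\mathcal{L}\ne\emptyset$: remove an element $(y^l,y^r)$ from $\mathcal{L}$; set $\lambda=(y^l_2-y^r_2,\,y^r_1-y^l_1)$; determine some $x^\ast\in\arg\min_{x\in\mathcal{X}}\lambda^Tg(x)$ and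 set $y^\ast=g(x^\ast)$; if $\lambda^Ty^\ast<\lambda^Ty^l$, add $y^\ast$ to $Y^\ast$, $x^\ast$ to $X^\ast$, and $(y^l,y^\ast),(y^\ast,y^r)$ to $\mathcal{L}$. Return $Y^\ast,X^\ast$. The minimization problems occurring in the algorithm are assumed to be solved exactly (by an oracle). *)

(* Defs.v *)
(* MathComp-Analysis development over an arbitrary [R : realType].
   Vectors of R^d are row vectors ['rV[R]_d]; the two components of a point of
   R^2 are [y 0 0] and [y 0 1]. *)
From HB Require Import structures.
From mathcomp Require Export all_boot all_order all_algebra finmap.
From mathcomp Require Export all_classical all_reals all_analysis.
Export Order.TTheory GRing.Theory Num.Theory numFieldNormedType.Exports.

Set Implicit Arguments.
Unset Strict Implicit.
Unset Printing Implicit Defensive.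

Local Open Scope classical_set_scope.
Local Open Scope ring_scope.

Definition convex_weights (R : realType) (N : nat) (t : 'I_N -> R) : Prop :=
  (forall i, 0 <= t i) /\ \sum_i t i = 1.

(* A polytope is the convex hull of finitely many points; with [N = 0] this
   allows the empty polytope. *)
Definition polytope (R : realType) (d : nat) (P : set 'rV[R]_d) : Prop :=
  exists (N : nat) (v : 'I_N -> 'rV[R]_d),
    P = [set x | exists2 t : 'I_N -> R,
                   convex_weights t & x = \sum_i t i *: v i].

(* P `&` (Z^k x R^(n-k)) *)
Definition mixed_integer (R : realType) (n k : nat) (P : set 'rV[R]_n)
    : set 'rV[R]_n :=
  [set x | P x /\ forall j : 'I_n, (j < k)%N -> x 0 j \is a Num.int].

(* "Linear on X" for a function of interest on X only: it agrees on X with a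
   linear form of the ambient space (X itself is not a subspace). *)
Definition linear_on (R : realType) (n : nat) (X : set 'rV[R]_n)
    (h : 'rV[R]_n -> R) : Prop :=
  exists l : {scalar 'rV[R]_n}, forall x, X x -> h x = l x.

Definition quasi_convex_on (R : realType) (m : nat) (U : set 'rV[R]_m)
    (h : 'rV[R]_m -> R) : Prop :=
  forall (xi xi' : 'rV[R]_m) (t : R), U xi -> U xi' -> 0 <= t <= 1 ->
    h (t *: xi + (1 - t) *: xi') <= Num.max (h xi) (h xi').

(* The real-valued [sup] is the genuine supremum whenever the values
   f_i(x, xi), xi in U, form a nonempty bounded set, e.g. if U is nonempty and
   compact and f_i(x, .) is continuous on U. *)
Definition robust_objective (R : realType) (n m : nat)
    (f : 'I_2 -> 'rV[R]_n -> 'rV[R]_m -> R) (U : set 'rV[R]_m)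
    (x : 'rV[R]_n) : 'rV[R]_2 :=
  \row_(i < 2) sup [set f i x xi | xi in U].

Definition vle (R : realType) (p : nat) (y z : 'rV[R]_p) : Prop :=
  forall i, y 0 i <= z 0 i.

Definition dominates (R : realType) (p : nat) (y z : 'rV[R]_p) : Prop :=
  vle y z /\ y <> z.

Definition efficient (R : realType) (n p : nat) (X : set 'rV[R]_n)
    (g : 'rV[R]_n -> 'rV[R]_p) : set 'rV[R]_n :=
  [set x | X x /\ ~ exists x', [/\ X x', x' <> x & dominates (g x') (g x)]].

Definition nondominated (R : realType) (n p : nat) (X : set 'rV[R]_n)
    (g : 'rV[R]_n -> 'rV[R]_p) : set 'rV[R]_p :=
  g @` efficient X g.

Definition extreme_supported_nondominated (R : realType) (n p : nat)
    (X : set 'rV[R]_n) (g : 'rV[R]_n -> 'rV[R]_p) : set 'rV[R]_p :=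
  [set y | (g @` X) y /\
    ~ exists (N : nat) (z : 'I_N -> 'rV[R]_p) (t : 'I_N -> R),
        [/\ forall i, nondominated X g (z i) /\ z i <> y,
            convex_weights t
          & vle (\sum_i t i *: z i) y]].

Definition representative_set (R : realType) (n p : nat) (X : set 'rV[R]_n)
    (g : 'rV[R]_n -> 'rV[R]_p) (S : set 'rV[R]_n) : Prop :=
  S `<=` X /\ g @` S = extreme_supported_nondominated X g.

Definition minimizers (R : realType) (T : Type) (A : set T) (h : T -> R)
    : set T :=
  [set x | A x /\ forall x', A x' -> h x <= h x'].

Record ds_state (R : realType) (n : nat) := DsState {
  ds_Y : {fset 'rV[R]_2};
  ds_X : {fset 'rV[R]_n};
  ds_L : {fset 'rV[R]_2 * 'rV[R]_2} }.

(* [lexmin X g i j] : the solutions in argmin {g_j(x) : x in X, g_i(x) <= eps}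
   for eps = min_X g_i. *)
Definition lexmin (R : realType) (n : nat) (X : set 'rV[R]_n)
    (g : 'rV[R]_n -> 'rV[R]_2) (i j : 'I_2) : set 'rV[R]_n :=
  [set x | exists2 x0, minimizers X (fun x' => g x' 0 i) x0
    & minimizers [set x' | X x' /\ g x' 0 i <= g x0 0 i]
                 (fun x' => g x' 0 j) x].

(* If y^L = y^R the search stops at once: the list is empty from the start. *)
Definition ds_start (R : realType) (n : nat) (X : set 'rV[R]_n)
    (g : 'rV[R]_n -> 'rV[R]_2) (s : ds_state R n) : Prop :=
  exists xL xR : 'rV[R]_n,
    [/\ lexmin X g 0 1 xL, lexmin X g 1 0 xR
      & s = if g xL == g xR then DsState [fset g xL] [fset xL] fset0
            else DsState [fset g xL; g xR] [fset xL; xR]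
                         [fset (g xL, g xR)] ]%fset.

Definition ds_weight (R : realType) (yl yr : 'rV[R]_2) : 'rV[R]_2 :=
  \row_(i < 2) (if i == 0 then yl 0 1 - yr 0 1 else yr 0 0 - yl 0 0).

Definition dot (R : realType) (p : nat) (w y : 'rV[R]_p) : R :=
  \sum_i w 0 i * y 0 i.

(* One iteration of the while-loop.  The choices of the pair removed from the
   list and of the minimizer are nondeterministic. *)
Definition ds_step (R : realType) (n : nat) (X : set 'rV[R]_n)
    (g : 'rV[R]_n -> 'rV[R]_2) (s s' : ds_state R n) : Prop :=
  exists (yl yr : 'rV[R]_2) (x : 'rV[R]_n),
    let w := ds_weight yl yr in
    let L := (ds_L s `\ (yl, yr))%fset in
    [/\ (yl, yr) \in ds_L s,
        minimizers X (fun x' => dot w (g x')) x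
      & s' = if dot w (g x) < dot w yl
             then DsState (g x |` ds_Y s) (x |` ds_X s)
                          ((yl, g x) |` ((g x, yr) |` L))
             else DsState (ds_Y s) (ds_X s) L ]%fset.

(* [ds_run X g N s] : some execution is in state [s] after [N] iterations. *)
Inductive ds_run (R : realType) (n : nat) (X : set 'rV[R]_n)
    (g : 'rV[R]_n -> 'rV[R]_2) : nat -> ds_state R n -> Prop :=
| DsRunStart s : ds_start X g s -> ds_run X g 0 s
| DsRunStep N s s' :
    ds_run X g N s -> ds_step X g s s' -> ds_run X g N.+1 s'.

Definition ds_returns (R : realType) (n : nat) (X : set 'rV[R]_n)
    (g : 'rV[R]_n -> 'rV[R]_2) (N : nat)
    (Ys : {fset 'rV[R]_2}) (Xs : {fset 'rV[R]_n}) : Prop :=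
  ds_run X g N (DsState Ys Xs fset0).

(* Every execution returns: the search can be started, an execution is never
   stuck while the list is nonempty (the scalarized problems do have optimal
   solutions), and no execution is infinite. *)
Definition ds_terminates (R : realType) (n : nat) (X : set 'rV[R]_n)
    (g : 'rV[R]_n -> 'rV[R]_2) : Prop :=
  [/\ exists s, ds_start X g s,
      forall N s, ds_run X g N s -> ds_L s <> fset0 ->
        exists s', ds_step X g s s'
    & ~ exists s : nat -> ds_state R n,
          ds_start X g (s 0%N) /\ forall i, ds_step X g (s i) (s i.+1)].

(* Main.v *)
Require Import Defs.
From mathcomp Require Import ring lra zify.

(* Quasi-convexity makes each supremum a maximum over the generators of U, so g
   is piecewise linear on a finite union of polyhedra and finitely many points
   V of g(X) suffice to minimize any two linear functions lexicographically.
   Every point found by the search lies on the lower left boundary of conv g(X);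
   the pairs in the list are disjoint intervals of this boundary, and splitting
   one strictly decreases the number of points of V inside it, which bounds the
   number of iterations.  A pair is discarded only when its chord supports
   conv g(X), so in the end every g(x) lies weakly above a segment spanned by
   Y*, and an extreme supported nondominated point must belong to Y*. *)

Set Implicit Arguments.
Unset Strict Implicit.
Unset Printing Implicit Defensive.

Local Open Scope classical_set_scope.
Local Open Scope ring_scope.

(** * Lexicographic minimization at the vertices of a polyhedron *)

Definition lex_le (R : realType) (S : Type) (a b : S -> R) (x y : S) : Prop :=
  a x < a y \/ a x = a y /\ b x <= b y.

Section LexVertex.
Variables (R : realType) (T : lmodType R).

Definition affine_fun (h : T -> R) : Prop :=
  forall x x' s, h (x + s *: (x' - x)) = h x + s * (h x' - h x).

Variables (W : set T) (I : finType) (h : I -> T -> R).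
Hypothesis W_affine : forall x x' s, W x -> W x' -> W (x + s *: (x' - x)).
Hypothesis h_affine : forall k, affine_fun (h k).
(** Along every ray of [W] some constraint decreases and, being affine, ends up negative: the
    polyhedron contains no ray. *)
Hypothesis no_recession :
  forall x x', W x -> W x' -> x <> x' -> exists k, h k x' < h k x.

Definition polyhedron : set T := [set x | W x /\ forall k, 0 <= h k x].

Definition active (x : T) : {set I} := [set k | h k x == 0].

(* Equivalently an extreme point of the polyhedron; in this form a vertex is
   determined by its active set. *)
Definition vertex : set T :=
  [set x | polyhedron x /\
     forall x', polyhedron x' -> active x \subset active x' -> x' = x].

Lemma finite_vertex : finite_set vertex.
Proof.
have inj : {in vertex &, injective active}.
  move=> x y; rewrite !inE => -[Px ux] [Py _] e.
  by apply/esym/ux => //; rewrite e.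
by rewrite -(eq_finite_set (inj_card_eq inj)); apply: finite_finset.
Qed.

Variables a b : T -> R.
Hypotheses (a_affine : affine_fun a) (b_affine : affine_fun b).

(** The ratio test of the simplex method: move from [x] towards [x'] until a first constraint
    becomes tight. Constraints active at [x] vanish on the whole line. The point [x'] itself may be
    infeasible. *)
Lemma more_active x x' : polyhedron x -> W x' -> x <> x' ->
    active x \subset active x' -> lex_le a b x' x ->
  exists y, [/\ polyhedron y, active x \proper active y & lex_le a b y x].
Proof.
move=> [Wx hx] Wx' xx' /fintype.subsetP sub lx.
have [k0 hk0] := no_recession Wx Wx' xx'.
(* The step length at which constraint [k] vanishes; the smallest one keeps all other constraints
   nonnegative. *)
pose ratio k := h k x / (h k x - h k x').
case: (@arg_minP _ _ _ k0 (fun k => h k x' < h k x) ratio hk0) => k hk kmin.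
have hkx : 0 < h k x.
  rewrite lt_neqAle hx andbT; apply/eqP => hk0'.
  have : k \in active x by rewrite inE -hk0'.
  by move/sub; rewrite inE => /eqP hk'; move: hk; rewrite hk' -hk0' ltxx.
have s0 : 0 < ratio k by rewrite divr_gt0// subr_gt0.
exists (x + ratio k *: (x' - x)); split.
- split; first exact: W_affine.
  move=> j; rewrite h_affine.
  have [jx|jx] := ltP (h j x') (h j x).
    have := kmin _ jx; rewrite [X in _ <= X]/ratio ler_pdivlMr ?subr_gt0//; lra.
  by rewrite addr_ge0// mulr_ge0 ?subr_ge0// ltW.
- apply/properP; split.
    apply/fintype.subsetP => j jx; have := sub _ jx.
    by move: jx; rewrite !inE h_affine => /eqP -> /eqP ->; rewrite subrr mulr0 addr0.
  exists k; last by rewrite inE gt_eqF.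
  rewrite inE h_affine /ratio; apply/eqP.
  have : h k x - h k x' != 0 by rewrite subr_eq0 gt_eqF.
  by move=> hne; field.
- rewrite /lex_le a_affine b_affine; case: lx => [lx|[e lx]]; [left; nra|right].
  by rewrite e; split; [ring|nra].
Qed.

(** Induction on the number of inactive constraints. *)
Lemma vertex_lex_le x : polyhedron x -> exists2 v, vertex v & lex_le a b v x.
Proof.
have [c] := ubnP #|~: active x|; elim: c => // c IH in x *.
rewrite ltnS => cx Px.
have [vx|nvx] := pselect (vertex x).
  by exists x => //; right; split.
have [x' [Px' sub xx']] : exists x',
    [/\ polyhedron x', active x \subset active x' & x <> x'].
  apply: contrapT => H; apply: nvx; split => // x' Px' s.
  by apply: contrapT => /nesym ne; apply: H; exists x'.
have [y [Py sy ly]] : exists y,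
    [/\ polyhedron y, active x \proper active y & lex_le a b y x].
  have [Wx _] := Px; have [Wx' _] := Px'.
  have [l|nl] := pselect (lex_le a b x' x); first exact: more_active Px Wx' _ _ _.
  (* If [x'] is lexicographically worse than [x], its reflection in [x] is not; the reflection lies
     in [W] but need not be feasible. *)
  apply: (@more_active x (x + (-1) *: (x' - x))) => //.
  - exact: W_affine.
  - rewrite scaleN1r -{1}[x]addr0 => /addrI/esym/eqP.
    by rewrite oppr_eq0 subr_eq0 => /eqP/esym.
  - apply/fintype.subsetP => k kx; have := fintype.subsetP sub _ kx.
    by move: kx; rewrite !inE h_affine => /eqP -> /eqP ->; rewrite subrr mulr0 addr0.
  - rewrite /lex_le a_affine b_affine.
    case: (ltgtP (a x') (a x)) => [l|l|e].
    + by case: nl; left.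
    + by left; lra.
    + right; split; first by rewrite e; ring.
      suff : b x <= b x' by lra.
      by rewrite leNgt; apply/negP => l; apply: nl; right; split=> //; exact: ltW.
have [|v vv lv] := IH y _ Py.
  by apply: leq_trans cx; apply: proper_card; rewrite properC.
exists v => //; move: lv ly; rewrite /lex_le => -[?|[? ?]] [?|[? ?]];
  [left|left|left|right]; try split; lra.
Qed.

End LexVertex.

(** * Lexicographic minima of finite sequences *)

Section LexMin.
Variables (R : realType) (S : eqType) (a b : S -> R).

Lemma lex_le_trans x y z : lex_le a b x y -> lex_le a b y z -> lex_le a b x z.
Proof.
by rewrite /lex_le => -[?|[? ?]] [?|[? ?]]; [left|left|left|right]; try split; lra.
Qed.

Lemma lex_le_total x y : lex_le a b x y \/ lex_le a b y x.
Proof.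
rewrite /lex_le; case: (ltgtP (a x) (a y)) => [h|h|->]; [by left; left|by right; left|].
by case: (leP (b x) (b y)) => [h|/ltW h]; [left|right]; right.
Qed.

Lemma seq_lex_min (s : seq S) :
  s != [::] -> exists2 v, v \in s & forall u, u \in s -> lex_le a b v u.
Proof.
elim: s => // x s IH _; have [->|s0] := eqVneq s [::].
  by exists x; [exact: mem_head|move=> u; rewrite inE => /eqP ->; right].
have [v vs vmin] := IH s0; have [xv|vx] := lex_le_total x v.
  exists x; first exact: mem_head.
  move=> u; rewrite inE => /predU1P[->|us]; first by right.
  exact: lex_le_trans xv (vmin _ us).
exists v; first by rewrite inE vs orbT.
by move=> u; rewrite inE => /predU1P[->|/vmin].
Qed.

End LexMin.

(** * Convex hulls and suprema of quasi-convex functions *)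

Section ConvexCombinations.
Variable R : realType.

Lemma convex_comb_closed (T : lmodType R) (K : set T) :
    (forall x y t, K x -> K y -> 0 <= t <= 1 -> K (t *: x + (1 - t) *: y)) ->
  forall N (v : 'I_N -> T) (t : 'I_N -> R),
    (forall i, K (v i)) -> convex_weights t -> K (\sum_i t i *: v i).
Proof.
move=> cK; elim=> [|N IH] v t Kv [t0].
  by rewrite big_ord0 => /esym/eqP; rewrite oner_eq0.
rewrite !big_ord_recl => t1.
have [e|ne] := eqVneq (t ord0) 1.
  have /psumr_eq0P z : \sum_(i < N) t (lift ord0 i) = 0 by lra.
  rewrite e scale1r big1 ?addr0// => i _.
  by rewrite z ?scale0r.
have S0 : 0 <= \sum_(i < N) t (lift ord0 i) by apply: sumr_ge0.
have lt1 : 0 < 1 - t ord0 by rewrite subr_gt0 lt_neqAle ne /=; lra.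
have -> : \sum_(i < N) t (lift ord0 i) *: v (lift ord0 i) = (1 - t ord0) *:
    \sum_(i < N) (t (lift ord0 i) / (1 - t ord0)) *: v (lift ord0 i).
  rewrite scaler_sumr; apply: eq_bigr => i _.
  by rewrite scalerA mulrCA divff ?mulr1// gt_eqF.
apply: cK => //; last by apply/andP; split=> //; lra.
apply: IH => //; split=> [i|]; first by rewrite divr_ge0// ltW.
rewrite -mulr_suml; have -> : \sum_(i < N) t (lift ord0 i) = 1 - t ord0 by lra.
by rewrite divff// gt_eqF.
Qed.

Lemma polytope_hull_convex (d N : nat) (v : 'I_N -> 'rV[R]_d) x y s :
    let K := [set x | exists2 t : 'I_N -> R,
                   convex_weights t & x = \sum_i t i *: v i] in
  K x -> K y -> 0 <= s <= 1 -> K (s *: x + (1 - s) *: y).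
Proof.
move=> K [t [t0 t1] ->] [u [u0 u1] ->] /andP[s0 s1].
exists (fun i => s * t i + (1 - s) * u i); first split=> [i|].
- by rewrite addr_ge0// mulr_ge0// subr_ge0.
- by rewrite big_split/= -!mulr_sumr t1 u1; ring.
- rewrite !scaler_sumr -big_split/=; apply: eq_bigr => i _.
  by rewrite !scalerA -scalerDl.
Qed.

Lemma hull_generator (d N : nat) (v : 'I_N -> 'rV[R]_d) j :
  exists2 t : 'I_N -> R, convex_weights t & v j = \sum_i t i *: v i.
Proof.
exists (fun i => (i == j)%:R).
  by split=> [i|]; rewrite ?ler0n// (bigD1 j)//= eqxx big1 ?addr0// => i /negbTE ->.
rewrite (bigD1 j)//= eqxx scale1r big1 ?addr0// => i /negbTE ->.
by rewrite scale0r.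
Qed.

(** The sublevel set of [h] in [U] at the largest generator value is convex and contains all
    generators, hence is all of [U]. *)
Lemma quasi_convex_sup (d N : nat) (v : 'I_N -> 'rV[R]_d) (h : 'rV[R]_d -> R) j :
    let U := [set x | exists2 t : 'I_N -> R,
                   convex_weights t & x = \sum_i t i *: v i] in
    quasi_convex_on U h -> (forall i, h (v i) <= h (v j)) ->
  sup [set h x | x in U] = h (v j).
Proof.
move=> U qc jmax; have ub x : U x -> h x <= h (v j).
  move=> [t tw ->].
  suff : [set x | U x /\ h x <= h (v j)] (\sum_i t i *: v i) by case.
  apply: convex_comb_closed => //= [{}x y s [Ux hx] [Uy hy] s01|i]; last first.
    by split=> //; exact: hull_generator.
  split; first exact: polytope_hull_convex.
  by apply: le_trans (qc _ _ _ Ux Uy s01) _; rewrite ge_max hx.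
have Uj : U (v j) by exact: hull_generator.
apply/eqP; rewrite eq_le; apply/andP; split.
  apply: ge_sup; first by exists (h (v j)), (v j).
  by move=> _ [x Ux <-]; exact: ub.
apply: ub_le_sup; last by exists (v j).
by exists (h (v j)) => _ [x Ux <-]; exact: ub.
Qed.

End ConvexCombinations.

(** * A finite lexicographic basis for the robust problem *)

Lemma dot2 (R : realType) (w y : 'rV[R]_2) :
  dot w y = w 0 0 * y 0 0 + w 0 1 * y 0 1.
Proof.
rewrite /dot !big_ord_recl big_ord0 addr0.
by congr (_ + w 0 _ * y 0 _); apply: val_inj.
Qed.

Lemma polytope_coord_bounded (R : realType) (n : nat) (P : set 'rV[R]_n) :
  polytope P -> exists B : nat, forall x, P x -> forall j, `|x 0 j| <= B%:R.
Proof.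
case=> N [p ->]; exists (Num.truncn (\sum_i \sum_j `|p i 0 j|)).+1 => _ [t [t0 t1] ->] j.
apply: le_trans (ltW (truncnS_gt _)).
rewrite summxE; apply: le_trans (ler_norm_sum _ _ _) _; apply: ler_sum => i _.
rewrite mxE normrM (bigD1 j)//= ger0_norm//.
apply: le_trans (_ : `|p i 0 j| <= _); last by rewrite lerDl sumr_ge0.
rewrite ler_piMl//.
by rewrite -t1 (bigD1 i)//= lerDl sumr_ge0.
Qed.

(** Encodes the bounded integer coordinates in a finite type, so that only finitely many regions
    arise. *)
Lemma int_shift_ord (R : realType) (B : nat) (x : R) :
  x \is a Num.int -> `|x| <= B%:R -> exists a : 'I_(2 * B).+1, x = a%:R - B%:R.
Proof.
move=> /intrP[z ->]; rewrite -intr_norm -[B%:R]/((B : int)%:~R) ler_int => zB.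
have lt : (absz (z + B%:Z)%R < (2 * B).+1)%N by lia.
exists (Ordinal lt) => /=.
rewrite pmulrn -intrB; congr (_%:~R); lia.
Qed.

Lemma dot_affine (R : realType) (T : lmodType R) (w : 'rV[R]_2)
    (l : 'I_2 -> T -> R) :
  (forall i, affine_fun (l i)) -> affine_fun (fun t => dot w (\row_i l i t)).
Proof. by move=> la x x' s; rewrite !dot2 !mxE !la; ring. Qed.

Section RobustLexBasis.
Variables (R : realType) (n m k : nat).
Variables (P : set 'rV[R]_n) (U : set 'rV[R]_m).
Variable f : 'I_2 -> 'rV[R]_n -> 'rV[R]_m -> R.
Hypotheses (hP : polytope P) (hU : polytope U) (hU0 : U !=set0).
Hypothesis hlin :
  forall i xi, U xi -> linear_on (mixed_integer k P) (fun x => f i x xi).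
Hypothesis hqc : forall i x, mixed_integer k P x -> quasi_convex_on U (f i x).

Let X := mixed_integer k P.
Let g := robust_objective f U.

(* X is covered by finitely many regions, one for each choice of the integer
   coordinates and of the generators of U attaining the two suprema.  On such a
   region g is linear, and in the convex weights t of the generators of P the
   region is a polyhedron. *)
Lemma robust_lex_basis :
  exists2 V : seq 'rV[R]_2, (forall v, v \in V -> (g @` X) v) &
    forall w w' x, X x -> exists2 v, v \in V & lex_le (dot w) (dot w') v (g x).
Proof.
have [B xB] := polytope_coord_bounded hP.
case: hP => N [p Pp]; case: hU => M [u Uu].
have Uu_ j : U (u j) by rewrite Uu; exact: hull_generator.
have [j0 _] : exists j : 'I_M, True.
  case: hU0 => xi; rewrite Uu => -[t [_ t1] _]; case: (M) t t1 => [|M'] t.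
    by rewrite big_ord0 => /esym/eqP; rewrite oner_eq0.
  by exists ord0.
pose l i j := projT1 (cid (hlin i (Uu_ j))).
have lE i j x : X x -> f i x (u j) = l i j x.
  by rewrite /l; case: cid => /= l' Hl; exact: Hl.
pose x_of (t : 'rV[R]_N) := \sum_i t 0 i *: p i.
have x_ofE t t' s : x_of (t + s *: (t' - t)) = x_of t + s *: (x_of t' - x_of t).
  rewrite /x_of -sumrB scaler_sumr -big_split/=; apply: eq_bigr => i _.
  by rewrite !mxE -scalerBl scalerA -scalerDl.
have l_affine i j : affine_fun (fun t => l i j (x_of t)).
  by move=> t t' s; rewrite x_ofE linearD linearZ linearB.
(* Here [r.1] holds the shifted integer coordinates and [r.2] the maximizing generator of each
   objective. Equations go into [W], inequalities into [h]. *)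
pose W (r : {ffun 'I_n -> 'I_(2 * B).+1} * {ffun 'I_2 -> 'I_M}) :=
  [set t : 'rV[R]_N | \sum_i t 0 i = 1 /\
     forall j : 'I_n, (j < k)%N -> x_of t 0 j = (r.1 j)%:R - B%:R].
pose h (r : {ffun 'I_n -> 'I_(2 * B).+1} * {ffun 'I_2 -> 'I_M})
    (c : 'I_N + 'I_2 * 'I_M) (t : 'rV[R]_N) :=
  match c with
  | inl i => t 0 i
  | inr ij => l ij.1 (r.2 ij.1) (x_of t) - l ij.1 ij.2 (x_of t)
  end.
have h_affine r c : affine_fun (h r c).
  case: c => [i|[i j]] t t' s /=; first by rewrite !mxE.
  by rewrite !l_affine; ring.
have W_affine r t t' s : W r t -> W r t' -> W r (t + s *: (t' - t)).
  move=> [t1 tj] [t'1 t'j]; split.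
    under eq_bigr do rewrite !mxE.
    by rewrite big_split/= -mulr_sumr sumrB t1 t'1; ring.
  by move=> j jk; rewrite x_ofE !mxE tj// t'j//; ring.
(* If no weight decreases, the equal sums force [t = t']. *)
have no_rec r t t' : W r t -> W r t' -> t <> t' -> exists c, h r c t' < h r c t.
  move=> [t1 _] [t'1 _] tt'; apply: contrapT => H; apply: tt'.
  have le i : t 0 i <= t' 0 i.
    by rewrite leNgt; apply/negP => lt; apply: H; exists (inl i).
  have /psumr_eq0P z : \sum_i (t' 0 i - t 0 i) = 0 by rewrite sumrB t1 t'1 subrr.
  apply/rowP => i; apply/esym/eqP; rewrite -subr_eq0; apply/eqP.
  by apply: z => // j _; rewrite subr_ge0.
have regP r t : polyhedron (W r) (h r) t ->
    X (x_of t) /\ g (x_of t) = \row_i l i (r.2 i) (x_of t).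
  move=> [[t1 tj] t0].
  have Xt : X (x_of t).
    split; last by move=> j jk; rewrite tj// rpredB// rpred_nat.
    rewrite Pp; exists (fun i => t 0 i) => //; split=> // i.
    exact: (t0 (inl i)).
  split=> //; apply/rowP => i; rewrite !mxE -lE// [in LHS]Uu.
  apply: quasi_convex_sup; first by rewrite -Uu; exact: hqc.
  by move=> j; rewrite !lE// -subr_ge0; exact: (t0 (inr (i, j))).
have regE x : X x -> exists r, exists2 t, polyhedron (W r) (h r) t & x_of t = x.
  move=> Xx; have [Px xint] := Xx.
  have [t tw xE] : exists2 t : 'I_N -> R, convex_weights t & x = \sum_i t i *: p i.
    by move: Px; rewrite {1}Pp.
  have /choice[a aE] : forall j : 'I_n, exists a : 'I_(2 * B).+1,
      (j < k)%N -> x 0 j = a%:R - B%:R.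
    move=> j; have [jk|kj] := ltnP j k; last by exists ord0.
    by have [a ->] := int_shift_ord (xint j jk) (xB _ Px j); exists a.
  have /choice[b bmax] : forall i, exists b, forall j, l i j x <= l i b x.
    move=> i; case: (arg_maxP (fun j => l i j x) (erefl : xpredT j0)) => b _ bmax.
    by exists b => j; exact: bmax.
  have xt : x_of (\row_i t i) = x by rewrite xE; apply: eq_bigr => i _; rewrite mxE.
  exists ([ffun j => a j], [ffun i => b i]); exists (\row_i t i) => //.
  split; first split=> /=.
  - by under eq_bigr do rewrite mxE; case: tw.
  - by move=> j jk; rewrite xt ffunE aE.
  - case=> [i|[i j]] /=; first by rewrite mxE; case: tw.
    by rewrite xt ffunE subr_ge0.
(* The basis consists of the images of all vertices of all regions. *)
have /finite_seqP[V VE] :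
    finite_set (\bigcup_(r in setT) ((g \o x_of) @` vertex (W r) (h r))).
  by apply: bigcup_finite => // r _; apply: finite_image; exact: finite_vertex.
have {}VE v : v \in V <-> exists r, exists2 t, vertex (W r) (h r) t & g (x_of t) = v.
  rewrite -[is_true _]/([set` V] v) -VE; split.
    by move=> [r _ [t vt <-]]; exists r, t.
  by move=> [r [t vt <-]]; exists r => //; exists t.
exists V => [v /VE[r [t [/regP[Xt _] _] <-]]|w w' x /regE[r [t Pt <-]]].
  by exists (x_of t).
have dot_g (w0 : 'rV[R]_2) :
    affine_fun (fun t : 'rV[R]_N => dot w0 (\row_i l i (r.2 i) (x_of t))).
  by apply: dot_affine => i.
have [v vv lv] := vertex_lex_le (@W_affine r) (@h_affine r) (@no_rec r)
  (dot_g w) (dot_g w') Pt.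
exists (g (x_of v)); first by apply/VE; exists r, v.
have [_ ->] := regP _ _ Pt; have [Pv _] := vv; have [_ ->] := regP _ _ Pv.
exact: lv.
Qed.

End RobustLexBasis.

(** * Counting, and points and chords in the plane *)

Lemma count_lt (T : eqType) (p q : pred T) (s : seq T) v :
  subpred p q -> v \in s -> q v -> ~~ p v -> (count p s < count q s)%N.
Proof.
move=> pq vs qv /negbTE pv; elim: s vs => //= u s IH.
rewrite inE => /predU1P[<-|/IH lt]; first by rewrite qv pv ltnS sub_count.
have : (p u <= q u)%N by case: (p u) (pq u) => // ->.
lia.
Qed.

Section BiobjectivePoints.
Variable R : realType.
Implicit Types y z w yl yr : 'rV[R]_2.

Lemma ord2P (i : 'I_2) : i = 0 \/ i = 1.
Proof. by case: i => -[|[|//]] ?; [left|right]; apply: val_inj. Qed.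

Lemma row2P y z : y 0 0 = z 0 0 -> y 0 1 = z 0 1 -> y = z.
Proof. by move=> h0 h1; apply/rowP => i; case: (ord2P i) => ->. Qed.

Lemma dot_delta (i : 'I_2) y : dot (delta_mx 0 i) y = y 0 i.
Proof.
by rewrite dot2 !mxE; case: (ord2P i) => -> /=; rewrite !(mul1r, mul0r, addr0, add0r).
Qed.

Lemma dot_weight yl yr y :
  dot (ds_weight yl yr) y =
    (yl 0 1 - yr 0 1) * y 0 0 + (yr 0 0 - yl 0 0) * y 0 1.
Proof. by rewrite dot2 !mxE. Qed.

(** The weighted sum is constant on the chord, so [y] lies on or above it; [t] selects the chord
    point with the first coordinate of [y]. *)
Lemma segment_le yl yr y : yl 0 0 < yr 0 0 ->
    yl 0 0 <= y 0 0 <= yr 0 0 ->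
    dot (ds_weight yl yr) yl <= dot (ds_weight yl yr) y ->
  exists2 t, 0 <= t <= 1 & vle (t *: yl + (1 - t) *: yr) y.
Proof.
move=> lr /andP[ly yr_]; rewrite !dot_weight => le.
have d0 : 0 < yr 0 0 - yl 0 0 by lra.
exists ((yr 0 0 - y 0 0) / (yr 0 0 - yl 0 0)).
  by apply/andP; split; [apply: divr_ge0; lra|rewrite ler_pdivrMr// mul1r; lra].
have d1 : yr 0 0 - yl 0 0 != 0 by rewrite gt_eqF.
move=> i; rewrite !mxE; case: (ord2P i) => ->.
  by rewrite le_eqVlt; apply/orP; left; apply/eqP; field.
set t := _ / _.
have -> : t * yl 0 1 + (1 - t) * yr 0 1 =
    ((yr 0 0 - y 0 0) * yl 0 1 + (y 0 0 - yl 0 0) * yr 0 1) / (yr 0 0 - yl 0 0).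
  by rewrite /t; field.
rewrite ler_pdivrMr//; lra.
Qed.

End BiobjectivePoints.

(** * Dichotomic search for an objective with a finite lexicographic basis *)

Section DichotomicSearch.
Variables (R : realType) (n : nat) (X : set 'rV[R]_n) (g : 'rV[R]_n -> 'rV[R]_2).
Variable V : seq 'rV[R]_2.
Hypothesis X0 : X !=set0.
Hypothesis V_img : forall v, v \in V -> (g @` X) v.
Hypothesis V_lex : forall w w' x, X x ->
  exists2 v, v \in V & lex_le (dot w) (dot w') v (g x).

Implicit Types (s : ds_state R n) (y z w yl yr : 'rV[R]_2).

(** A best element of the finite list [V] is best on all of [X]. *)
Lemma lex_minimizer w w' :
  exists2 x, X x & forall x', X x' -> lex_le (dot w) (dot w') (g x) (g x').
Proof.
have V0 : V != [::].
  by case: X0 => x /(V_lex w w')[v vV _]; apply: contraTneq vV => ->.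
have [v vV vmin] := seq_lex_min (dot w) (dot w') V0.
have [x Xx gx] := V_img vV; exists x => // x' /(V_lex w w')[u /vmin vu uy].
by rewrite gx; exact: lex_le_trans vu uy.
Qed.

Lemma minimizers_dot w : minimizers X (fun x => dot w (g x)) !=set0.
Proof.
have [x Xx xmin] := lex_minimizer w w; exists x; split=> // x' /xmin.
by case=> [/ltW//|[->]].
Qed.

Lemma lexmin_ex i j : lexmin X g i j !=set0.
Proof.
have [x Xx xmin] := lex_minimizer (delta_mx 0 i) (delta_mx 0 j).
have imin x' : X x' -> g x 0 i <= g x' 0 i.
  by move/xmin; rewrite /lex_le !dot_delta => -[/ltW//|[->]].
exists x, x; first by split.
split=> [|x' [Xx' x'i]]; first by split.
have [|[_]] := xmin _ Xx'; rewrite !dot_delta//.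
by move=> /lt_le_trans/(_ x'i); rewrite ltxx.
Qed.

Lemma lexminP i j x : lexmin X g i j x ->
  [/\ X x, forall x', X x' -> g x 0 i <= g x' 0 i &
      forall x', X x' -> g x' 0 i <= g x 0 i -> g x 0 j <= g x' 0 j].
Proof.
move=> [x0 [Xx0 min0] [[Xx xx0] minx]]; split=> // [x' Xx'|x' Xx' le].
  exact: le_trans xx0 (min0 _ Xx').
by apply: minx; split=> //; exact: le_trans le xx0.
Qed.

(* A nondominated point lying on or below every chord between attained points,
   stated without divisions: it is on the lower left boundary of the convex
   hull of the image. *)
Definition on_lower_hull y : Prop :=
  [/\ (g @` X) y,
      forall z, (g @` X) z -> z 0 0 <= y 0 0 -> z 0 1 <= y 0 1 -> z = y &
      forall z z', (g @` X) z -> (g @` X) z' -> z 0 0 < y 0 0 < z' 0 0 ->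
        (z' 0 0 - z 0 0) * y 0 1 <=
          (y 0 0 - z 0 0) * z' 0 1 + (z' 0 0 - y 0 0) * z 0 1].

(** No image point lies further left, so the chord condition is vacuous. *)
Lemma on_lower_hull_left x : lexmin X g 0 1 x -> on_lower_hull (g x).
Proof.
move=> /lexminP[Xx min0 min1]; split=> [|_ [z Xz <-] z0 z1|_ z' [z Xz <-] _]; first by exists x.
  by apply: row2P; apply/eqP; rewrite eq_le ?z0 ?z1/=; [exact: min0|exact: min1].
by move=> /andP[/lt_le_trans/(_ (min0 _ Xz))]; rewrite ltxx.
Qed.

(** Both ends of any chord are at least as high as this point. *)
Lemma on_lower_hull_right x : lexmin X g 1 0 x -> on_lower_hull (g x).
Proof.
move=> /lexminP[Xx min1 min0].
split=> [|_ [z Xz <-] z0 z1|_ _ [z Xz <-] [z' Xz' <-] /andP[lt lt']]; first by exists x.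
  by apply: row2P; apply/eqP; rewrite eq_le ?z0 ?z1/=; [exact: min0|exact: min1].
by have := min1 _ Xz; have := min1 _ Xz'; nra.
Qed.

(** Positive weights exclude domination; the chord condition is a nonnegative combination of the
    optimality inequalities at the two ends. *)
Lemma on_lower_hull_minimizer w x : 0 < w 0 0 -> 0 < w 0 1 ->
  minimizers X (fun x' => dot w (g x')) x -> on_lower_hull (g x).
Proof.
move=> w0 w1 [Xx xmin].
split=> [|_ [z Xz <-] z0 z1|_ _ [z Xz <-] [z' Xz' <-] /andP[lt lt']]; first by exists x.
  by have := xmin _ Xz; rewrite !dot2 => le; apply: row2P; nra.
have := xmin _ Xz; have := xmin _ Xz'; rewrite !dot2 => le' le.
rewrite -(ler_pM2l w1).
have : 0 < g z' 0 0 - g x 0 0 by lra.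
have : 0 < g x 0 0 - g z 0 0 by lra.
nra.
Qed.

Lemma on_lower_hull_inj y z :
  on_lower_hull y -> on_lower_hull z -> y 0 0 = z 0 0 -> y = z.
Proof.
move=> [yX ymin _] [zX zmin _] e.
by have [le|/ltW le] := leP (y 0 1) (z 0 1); [apply: zmin|apply/esym/ymin];
  rewrite ?e.
Qed.

(** Were [z] left of [yl], then [yl] would lie above the chord from [z] to [yr]; straight below
    [yl], it would dominate [yl]. The right side is symmetric. *)
Lemma below_chord_between yl yr z :
    on_lower_hull yl -> on_lower_hull yr -> yl 0 0 < yr 0 0 ->
    (g @` X) z -> dot (ds_weight yl yr) z < dot (ds_weight yl yr) yl ->
  yl 0 0 < z 0 0 < yr 0 0.
Proof.
move=> [ylX ylmin ylc] [yrX yrmin yrc] lr zX; rewrite !dot_weight => lt.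
rewrite !ltNge -negb_or; apply/negP => /orP[].
  rewrite le_eqVlt => /predU1P[e|zl].
    have zl : z 0 1 < yl 0 1 by rewrite e in lt; nra.
    by move: (zl); rewrite (ylmin _ zX _ (ltW zl)) ?e// ltxx.
  have := ylc _ _ zX yrX; rewrite zl lr => /(_ isT); lra.
rewrite le_eqVlt => /predU1P[e|rz].
  have zr : z 0 1 < yr 0 1 by rewrite -e in lt; nra.
  by move: (zr); rewrite (yrmin _ zX _ (ltW zr)) -?e// ltxx.
have := yrc _ _ ylX zX; rewrite rz lr => /(_ isT); lra.
Qed.

Lemma on_lower_hull_nondominated y : on_lower_hull y -> nondominated X g y.
Proof.
move=> [[x Xx <-] ymin _]; exists x => //; split=> // -[x' [Xx' _ [le ne]]].
by apply: ne; apply: ymin; [exists x'|exact: le..].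
Qed.

(** * Covering segments and the loop invariant *)

Definition covered (Y : {fset 'rV[R]_2}) z : Prop :=
  exists a b t, [/\ a \in Y, b \in Y, 0 <= t <= 1 & vle (t *: a + (1 - t) *: b) z].

(** Otherwise the ends of the covering segment are nondominated points other than [y], against
    extremality. *)
Lemma extreme_supported_covered (Y : {fset 'rV[R]_2}) y :
    (forall a, a \in Y -> on_lower_hull a) ->
    extreme_supported_nondominated X g y -> covered Y y ->
  y \in Y.
Proof.
move=> hY [_ yext] [a [b [t [aY bY /andP[t0 t1] le]]]].
apply/negPn/negP => yY; apply: yext.
exists 2%N, (fun i => if i == 0 then a else b), (fun i => if i == 0 then t else 1 - t).
split.
- have ne z : z \in Y -> nondominated X g z /\ z <> y.
    move=> zY; split; first exact/on_lower_hull_nondominated/hY.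
    by move=> zy; rewrite -zy zY in yY.
  by move=> i; case: ifP => _; exact: ne.
- split=> [i|]; first by case: ifP; rewrite ?subr_ge0.
  by rewrite !big_ord_recl big_ord0/=; ring.
- by rewrite !big_ord_recl big_ord0/= addr0.
Qed.

(** An image point not yet covered lies in the vertical strip of a listed pair. In the count, a
    split raises [N], the list and [ds_Y] by one each; a rejection raises [N] and shrinks the list.
    The first alternative is the immediate stop. *)
Record ds_inv (N : nat) s : Prop := DsInv {
  inv_hull : forall y, y \in ds_Y s -> on_lower_hull y;
  inv_feasible : forall x, x \in ds_X s -> X x;
  inv_preimage : forall y, y \in ds_Y s -> exists2 x, x \in ds_X s & g x = y;
  inv_pair : forall a b, (a, b) \in ds_L s ->
    [/\ a \in ds_Y s, b \in ds_Y s, a 0 0 < b 0 0, b 0 1 < a 0 1 &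
        forall y, y \in ds_Y s -> ~~ (a 0 0 < y 0 0 < b 0 0)];
  inv_cover : forall x, X x -> covered (ds_Y s) (g x) \/
    exists a b, (a, b) \in ds_L s /\ a 0 0 <= g x 0 0 <= b 0 0;
  inv_count : [/\ N = 0%N, #|` ds_Y s| = 1%N & ds_L s = fset0] \/
    (1 < #|` ds_Y s|)%N /\ (N + #|` ds_L s| + 3 = 2 * #|` ds_Y s|)%N }.

Lemma ds_start_inv s : ds_start X g s -> ds_inv 0 s.
Proof.
move=> [xL [xR [lexL lexR ->]]].
have hL := on_lower_hull_left lexL; have hR := on_lower_hull_right lexR.
have [XxL minL0 minL1] := lexminP lexL; have [XxR minR1 minR0] := lexminP lexR.
have cover (Y : {fset 'rV[R]_2}) a x : a \in Y -> a 0 0 <= g x 0 0 -> a 0 1 <= g x 0 1 ->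
    covered Y (g x).
  move=> aY a0 a1; exists a, a, 1; split=> //; first by rewrite ler01 lexx.
  by move=> i; rewrite subrr scale0r addr0 scale1r; case: (ord2P i) => ->.
case: eqP => [e|ne]; split=> /=.
- by move=> y /fset1P ->.
- by move=> x /fset1P ->.
- by move=> y /fset1P ->; exists xL => //; exact: fset11.
- by [].
- by move=> x Xx; left; apply: (@cover _ (g xL)); rewrite ?fset11 ?minL0// e minR1.
- by left; rewrite cardfs1.
- by move=> y /fset2P[] ->.
- by move=> x /fset2P[] ->.
- by move=> y /fset2P[] ->; [exists xL|exists xR] => //; rewrite !inE eqxx ?orbT.
- move=> a b /fset1P[-> ->].
  have lt0 : g xL 0 0 < g xR 0 0.
    rewrite lt_neqAle minL0// andbT; apply/eqP => e; apply: ne.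
    exact: on_lower_hull_inj hL hR e.
  have lt1 : g xR 0 1 < g xL 0 1.
    rewrite lt_neqAle minR1// andbT; apply/eqP => e; apply: ne.
    case: hR => _ hmin _; apply: hmin; [by exists xL|exact: minL0|by rewrite e].
  split; rewrite ?inE ?eqxx ?orbT// => y /fset2P[] ->; rewrite ltxx ?andbF//.
- move=> x Xx; have [le|/ltW le] := leP (g x 0 0) (g xR 0 0).
    by right; exists (g xL), (g xR); rewrite fset11 le minL0.
  by left; apply: (@cover _ (g xR)); rewrite ?minR1// !inE eqxx orbT.
- by right; rewrite cardfs1 cardfs2; move/eqP: ne => ->.
Qed.

Lemma ds_step_inv N s s' : ds_inv N s -> ds_step X g s s' -> ds_inv N.+1 s'.
Proof.
move=> inv [yl [yr [x [lrL xmin ->]]]].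
have [ylY yrY lt0 lt1 empty] := inv_pair inv lrL.
have hl := inv_hull inv ylY; have hr := inv_hull inv yrY.
have [Xx wmin] := xmin.
have cnt : (1 < #|` ds_Y s|)%N /\ (N + #|` ds_L s| + 3 = 2 * #|` ds_Y s|)%N.
  by case: (inv_count inv) => // -[_ _ L0]; rewrite L0 in lrL.
have cardL : #|` ds_L s| = #|` (ds_L s `\ (yl, yr))%fset|.+1.
  by rewrite (cardfsD1 (yl, yr)) lrL.
case: ifP => [lt|nlt].
- have hx : on_lower_hull (g x).
    by apply: on_lower_hull_minimizer xmin; rewrite !mxE/= subr_gt0.
  have gX : (g @` X) (g x) by exists x.
  have btw := below_chord_between hl hr lt0 gX lt.
  have /andP[lx xr] := btw.
  have gY : g x \notin ds_Y s by apply: contraL btw => /empty.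
  have lx1 : g x 0 1 < yl 0 1.
    rewrite ltNge; apply/negP => le; have [ylX _ _] := hl; have [_ hmin _] := hx.
    by move: (lx); rewrite (hmin _ ylX (ltW lx) le) ltxx.
  have xr1 : yr 0 1 < g x 0 1.
    rewrite ltNge; apply/negP => le; have [_ hmin _] := hr.
    by move: (xr); rewrite (hmin _ gX (ltW xr) le) ltxx.
  split=> /=.
  + by move=> y /fset1UP[->//|]; exact: (inv_hull inv).
  + by move=> z /fset1UP[->//|]; exact: (inv_feasible inv).
  + move=> y /fset1UP[->|/(inv_preimage inv)[z zX <-]].
      by exists x => //; rewrite !inE eqxx.
    by exists z => //; rewrite !inE zX orbT.
  + move=> a b; rewrite !inE => /or3P[/eqP[-> ->]|/eqP[-> ->]|/andP[ne abL]].
    * split; rewrite ?inE ?eqxx ?ylY ?orbT// => y /fset1UP[->|/empty].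
        by rewrite ltxx andbF.
      by apply: contra => /andP[-> /lt_trans ->].
    * split; rewrite ?inE ?eqxx ?yrY ?orbT// => y /fset1UP[->|/empty].
        by rewrite ltxx.
      by apply: contra => /andP[/(lt_trans lx) -> ->].
    * have [aY bY ab0 ab1 abe] := inv_pair inv abL.
      split; rewrite ?inE ?aY ?bY ?orbT// => y /fset1UP[->|/abe//].
      (* If [g x] lay inside an older pair, that interval would overlap the one being split; as
         neither contains an endpoint of the other, the pairs would coincide. *)
      apply: contra ne => /andP[ax xb].
      have := empty _ aY; have := empty _ bY; have := abe _ ylY; have := abe _ yrY.
      rewrite (lt_trans lx xb) (lt_trans ax xr) !andbT /= -!leNgt => h1 h2 h3 h4.
      have ea : a 0 0 = yl 0 0 by apply/eqP; rewrite eq_le h4 h2.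
      have eb : b 0 0 = yr 0 0 by apply/eqP; rewrite eq_le h1 h3.
      rewrite (on_lower_hull_inj (inv_hull inv aY) hl ea).
      by rewrite (on_lower_hull_inj (inv_hull inv bY) hr eb).
  + move=> z Xz; case: (inv_cover inv Xz) => [[a [b [t [aY bY t01 le]]]]|].
      by left; exists a, b, t; rewrite !inE aY bY !orbT.
    move=> [a [b [abL zab]]]; right; have [e|ne] := eqVneq (a, b) (yl, yr).
      case: e zab => -> -> /andP[lz zr].
      have [zx|/ltW xz] := leP (g z 0 0) (g x 0 0).
        by exists yl, (g x); rewrite !inE eqxx lz zx.
      by exists (g x), yr; rewrite !inE eqxx xz zr orbT.
    by exists a, b; rewrite !inE ne abL !orbT.
  + right.
    (* The list is a set, so the exact count requires that both added pairs are new. *)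
    have fresh a : (a, g x) \notin ds_L s /\ (g x, a) \notin ds_L s.
      by split; apply/negP => /(inv_pair inv)[]; rewrite ?(negbTE gY).
    have -> : #|` (g x |` ds_Y s)%fset| = #|` ds_Y s|.+1 by rewrite cardfsU1 gY.
    have ne : (yl, g x) != (g x, yr).
      by apply/eqP => -[e _]; rewrite e ltxx in lx.
    rewrite !cardfsU1 !inE (negbTE ne) (negbTE (fresh yl).1) (negbTE (fresh yr).2).
    rewrite !andbF /=; case: cnt; rewrite cardL.
    by move: #|` _| #|` _| => c d; lia.
- split=> /=.
  + exact: inv_hull inv.
  + exact: inv_feasible inv.
  + exact: inv_preimage inv.
  + by move=> a b; rewrite !inE => /andP[_]; exact: (inv_pair inv).
  + move=> z Xz; case: (inv_cover inv Xz) => [?|[a [b [abL zab]]]]; first by left.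
    have [e|ne] := eqVneq (a, b) (yl, yr); last first.
      by right; exists a, b; rewrite !inE ne abL.
    left; case: e zab => -> -> zlr.
    (* On rejection the chord attains the minimum of the weighted sum, so no image point lies below
       it. *)
    have le : dot (ds_weight yl yr) yl <= dot (ds_weight yl yr) (g z).
      by apply: le_trans (wmin _ Xz); rewrite leNgt nlt.
    by have [t t01 ht] := segment_le lt0 zlr le; exists yl, yr, t.
  + by right; case: cnt; rewrite cardL; move: #|` _| #|` _| => c d; lia.
Qed.

Lemma ds_run_inv N s : ds_run X g N s -> ds_inv N s.
Proof.
by elim=> [t|M t t' _]; [exact: ds_start_inv|exact: ds_step_inv].
Qed.

(** * Termination and correctness *)

Definition strictly_between (q : 'rV[R]_2 * 'rV[R]_2) : pred 'rV[R]_2 :=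
  fun v => q.1 0 0 < v 0 0 < q.2 0 0.

(** Base 3 makes the sum drop when a pair with [c + 1] points of [V] is replaced by two with at most
    [c] each; a rejected pair removes a positive term. *)
Definition ds_measure s : nat :=
  \sum_(q <- ds_L s) 3 ^ count (strictly_between q) V.

(* Some point of V minimizes the weighted sum on either side of the new point
   (weakly), hence both new intervals contain fewer points of V; this also
   covers a new point in the relative interior of an edge of the hull. *)
Lemma ds_measure_step N s s' :
  ds_inv N s -> ds_step X g s s' -> (ds_measure s' < ds_measure s)%N.
Proof.
move=> inv [yl [yr [x [lrL xmin ->]]]].
have [ylY yrY lt0 lt1 empty] := inv_pair inv lrL.
have hl := inv_hull inv ylY; have hr := inv_hull inv yrY.
have [Xx wmin] := xmin.
rewrite /ds_measure (big_fsetD1 _ lrL)/=; case: ifP => [lt|_] /=; last first.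
  by rewrite -[X in (X < _)%N]add0n ltn_add2r expn_gt0.
have gX : (g @` X) (g x) by exists x.
have btw := below_chord_between hl hr lt0 gX lt; have /andP[lx xr] := btw.
(* Since [g x] is optimal, [v] ties with it in the weighted sum, and [w'] breaks the tie; [v] is
   below the chord, hence between [yl] and [yr]. *)
have V_min w' : exists2 v, v \in V & strictly_between (yl, yr) v /\ dot w' v <= dot w' (g x).
  have [v vV lv] := V_lex (ds_weight yl yr) w' Xx.
  have [z Xz gz] := V_img vV; exists v => //.
  have /= le := wmin _ Xz; rewrite gz in le.
  case: lv => [/lt_le_trans/(_ le)|[e ?]]; first by rewrite ltxx.
  by split=> //; apply: below_chord_between; rewrite ?e//; exists z.
have lt_l : (count (strictly_between (yl, g x)) V < count (strictly_between (yl, yr)) V)%N.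
  (* This tie-break puts [v] at or to the right of [g x], hence outside the left interval. *)
  have [v vV [bv]] := V_min (- delta_mx 0 0).
  rewrite !dot2 !mxE /= => le; apply: (count_lt _ vV bv).
    by move=> u /andP[/= h1 h2]; rewrite /strictly_between /= h1 (lt_trans h2 xr).
  by rewrite /strictly_between /= negb_and -!leNgt orbC; apply/orP; left; lra.
have lt_r : (count (strictly_between (g x, yr)) V < count (strictly_between (yl, yr)) V)%N.
  have [v vV [bv]] := V_min (delta_mx 0 0).
  rewrite !dot_delta => le; apply: (count_lt _ vV bv).
    by move=> u /andP[/= h1 h2]; rewrite /strictly_between /= h2 (lt_trans lx h1).
  by rewrite /strictly_between /= negb_and -!leNgt le.
have gY : g x \notin ds_Y s by apply: contraL btw => /empty.
have fresh a : (a, g x) \notin ds_L s /\ (g x, a) \notin ds_L s.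
  by split; apply/negP => /(inv_pair inv)[]; rewrite ?(negbTE gY).
have ne : (yl, g x) != (g x, yr).
  by apply/eqP => -[e _]; rewrite e ltxx in lx.
rewrite !big_fsetU1/=; first last.
- by rewrite !inE (negbTE (fresh yl).1) (negbTE ne) andbF.
- by rewrite !inE (negbTE (fresh yr).2) andbF.
rewrite addnA ltn_add2r.
move: lt_l lt_r; case: (count (strictly_between (yl, yr)) V) => // c.
rewrite !ltnS => /(leq_pexp2l (isT : (0 < 3)%N)) h1 /(leq_pexp2l (isT : (0 < 3)%N)) h2.
have : (0 < 3 ^ c)%N by rewrite expn_gt0.
by rewrite expnS; move: (3 ^ c)%N (3 ^ _)%N (3 ^ _)%N h1 h2 => p q r; lia.
Qed.

Lemma ds_terminates_of_basis : ds_terminates X g.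
Proof.
split.
- have [xL lL] := lexmin_ex 0 1; have [xR lR] := lexmin_ex 1 0.
  by eexists; exists xL, xR; split.
- move=> N s _ /eqP/fset0Pn[[yl yr] lrL].
  have [x xmin] := minimizers_dot (ds_weight yl yr).
  by eexists; exists yl, yr, x; split.
- move=> [s [s0 step]].
  have run i : ds_run X g i (s i).
    by elim: i => [|i IH]; [exact: DsRunStart|exact: DsRunStep IH (step i)].
  have dec i : (ds_measure (s i) + i <= ds_measure (s 0))%N.
    elim: i => [|i IH]; first by rewrite addn0.
    have := ds_measure_step (ds_run_inv (run i)) (step i); lia.
  (* An execution has at most as many steps as its initial measure. *)
  by have := dec (ds_measure (s 0)).+1; rewrite addnS ltnNge leq_addl.
Qed.

(** With the list empty, the invariant leaves every image point covered and determines [N]. *)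
Lemma ds_returns_correct N (Ys : {fset 'rV[R]_2}) (Xs : {fset 'rV[R]_n}) :
    ds_returns X g N Ys Xs ->
  [/\ extreme_supported_nondominated X g `<=` [set` Ys],
      exists2 S : set 'rV[R]_n, S `<=` [set` Xs] & representative_set X g S,
      (2 < #|` Ys|)%N -> N = (2 * #|` Ys| - 3)%N
    & #|` Ys| = 1%N -> N = 0%N].
Proof.
move=> /ds_run_inv[/= hull feas pre _ cover cnt].
have ext y : extreme_supported_nondominated X g y -> y \in Ys.
  move=> ye; apply: (extreme_supported_covered hull ye).
  by case: ye => -[x Xx <-] _; case: (cover _ Xx) => // -[a [b []]].
split=> //.
(* The returned solutions with extreme supported image; each point of [Ys] has a preimage in
   [Xs]. *)
- exists [set x | x \in Xs /\ extreme_supported_nondominated X g (g x)].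
    by move=> x [].
  split; first by move=> x [/feas].
  rewrite eqEsubset; split=> [_ [x [_ ?] <-]//|y ye].
  by have [x xX gx] := pre _ (ext _ ye); exists x => //; split=> //; rewrite gx.
- by case: cnt => [[_ -> _]//|[_ e] _]; lia.
- by case: cnt => [[]//|[c _] e]; rewrite e in c.
Qed.

End DichotomicSearch.

Theorem lemma7 (R : realType) (n m k : nat)
  (P : set 'rV[R]_n) (U : set 'rV[R]_m)
  (f : 'I_2 -> 'rV[R]_n -> 'rV[R]_m -> R)
  (hk : (k <= n)%N)
  (hP : polytope P)
  (hX0 : mixed_integer k P !=set0)
  (hU : polytope U)
  (hU0 : U !=set0)
  (hlin : forall i xi, U xi -> linear_on (mixed_integer k P) (fun x => f i x xi))
  (hqc : forall i x, mixed_integer k P x -> quasi_convex_on U (f i x))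
  (hcont : forall i x, mixed_integer k P x -> {within U, continuous (f i x)}) :
  let X := mixed_integer k P in
  let g := robust_objective f U in
  ds_terminates X g /\
  forall (N : nat) (Ys : {fset 'rV[R]_2}) (Xs : {fset 'rV[R]_n}),
    ds_returns X g N Ys Xs ->
    [/\ extreme_supported_nondominated X g `<=` [set` Ys],
        exists2 S : set 'rV[R]_n, S `<=` [set` Xs] & representative_set X g S,
        (2 < #|` Ys|)%N -> N = (2 * #|` Ys| - 3)%N
      & #|` Ys| = 1%N -> N = 0%N].
Proof.
have [V V_img V_lex] := robust_lex_basis hP hU hU0 hlin hqc.
split; first exact: ds_terminates_of_basis hX0 V_img V_lex.
by move=> N Ys Xs; exact: ds_returns_correct.
Qed.
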